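(* Let $(G_0,\mathfrak{g})$ be a super Harish-Chandra pair and let $U\subseteq G_0$ be open. The representation $\hat\varphi|_{\mathfrak{g}_{\bar0}}:\mathfrak{g}_{\bar0}\to\mathrm{Der}_{\mathbb{R}}(\mathcal{C}^\infty(U)\otimes\Lambda(\mathfrak{g}_{\bar1}^* ))$ satisfies $$\hat\varphi(a)=\hat\varphi_0(a)$$ for every $a\in\mathfrak{g}_{\bar0}$. In particular it preserves the $\mathbb{Z}$-gradation of $\mathcal{C}^\infty(U)\otimes\Lambda(\mathfrak{g}_{\bar1}^* )$.
   Context: A super Harish-Chandra pair $(G_0,\mathfrak{g})$ consists of a Lie group $G_0$ and a (real, finite-dimensional) Lie superalgebra $\mathfrak{g}=\mathfrak{g}_{\bar0}+\mathfrak{g}_{\bar1}$ with $\mathfrak{g}_{\bar0}=\mathrm{Lie}(G_0)$, and a morphism $\mathrm{Ad}:G_0\to\mathrm{Aut}(\mathfrak{g})$ extending the adjoint action on $\mathfrak{g}_{\bar0}$ whose differential is $\mathrm{ad}|_{\mathfrak{g}_{\bar0}}$; $\mathrm{Ad}$ is extended to the universal enveloping algebra $\mathcal{U}(\mathfrak{g})$. Let $\varphi_0,\hat\varphi_0:\mathfrak{g}_{\bar0}\to\mathcal{T}(G_0)$ be the representations by left-invariant, resp. right-invariant, vector fields of $G_0$: $(\varphi_0(a)f)(g)=\frac{d}{dt}|_{0}f(g\exp(ta))$, $(\hat\varphi_0(a)f)(g)=\frac{d}{dt}|_{0}f(\exp(ta)g)$. Via $\varphi_0$, $\mathcal{C}^\infty(U)$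 is a left $\mathcal{U}(\mathfrak{g}_{\bar0})$-module. The structure sheaf of the associated Lie supergroup is $\mathcal{A}_G(U)=\mathrm{Hom}_{\mathcal{U}(\mathfrak{g}_{\bar0})}(\mathcal{U}(\mathfrak{g}),\mathcal{C}^\infty(U))$, with convolution product $F_1*F_2=m_{\mathcal{C}^\infty}\circ(F_1\otimes F_2)\circ\Delta_{\mathcal{U}(\mathfrak{g})}$. The representation by right-invariant vector fields is the anti-homomorphism $\hat\varphi:\mathfrak{g}\to\mathrm{Der}_{\mathbb{R}}(\mathcal{A}_G(U))$, $$(\hat\varphi(a)F)(u)(g)=(-1)^{|F||a|}F((\mathrm{Ad}_{g^{-1}}a)\cdot u)(g),\qquad u\in\mathcal{U}(\mathfrak{g}),\ g\in U.$$ Let $\gamma:\Lambda(\mathfrak{g}_{\bar1})\to\mathcal{U}(\mathfrak{g})$, $\gamma(a_1\wedge\dots\wedge a_p)=\frac1{p!}\sum_{\sigma}\mathrm{sgn}(\sigma)a_{\sigma(1)}\cdots a_{\sigma(p)}$. The map $F\mapsto f=F\circ\gamma$ is an isomorphism of superalgebras $\mathcal{A}_G(U)\cong\mathrm{Hom}_{\mathbb{R}}(\Lambda(\mathfrak{g}_{\bar1}),\mathcal{C}^\infty(U))\cong\mathcal{C}^\infty(U)\otimes\Lambda(\mathfrak{g}_{\bar1}^* )$, through which $\hat\varphi$ is regarded as acting by derivations of $\mathcal{C}^\infty(U)\otimes\Lambda(\mathfrak{g}_{\bar1}^* )$; the $\mathbb{Z}$-gradation is the exterior degree. A vector field $X$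 on $U$ is regarded as the derivation of $\mathcal{C}^\infty(U)\otimes\Lambda(\mathfrak{g}_{\bar1}^* )$ acting as $X$ on $\mathcal{C}^\infty(U)$ and as zero on $\mathfrak{g}_{\bar1}^*$; in this sense $\hat\varphi_0(a)$ denotes a derivation of $\mathcal{C}^\infty(U)\otimes\Lambda(\mathfrak{g}_{\bar1}^* )$. *)

(* Defs.v *)
From HB Require Import structures.
From mathcomp Require Import all_boot all_order all_algebra all_fingroup.
From mathcomp Require Import all_classical all_reals all_analysis.
From mathcomp Require Import generic_quotient monoid.

Set Implicit Arguments.
Unset Strict Implicit.
Unset Printing Implicit Defensive.

Import Order.TTheory GRing.Theory Num.Theory.
Import numFieldNormedType.Exports.

Local Open Scope classical_set_scope.
Local Open Scope ring_scope.

(* [spart false] is the even part and [spart true] the odd part. *)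
HB.mixin Record isLieSuperalgebra (R : fieldType) g of Vector R g := {
  spart : bool -> {vspace g};
  sbracket : g -> g -> g;
  spart_cap : (spart false :&: spart true = 0)%VS;
  spart_sum : (spart false + spart true = fullv)%VS;
  sbracketPl : forall (k : R) (x y z : g),
    sbracket (k *: x + y) z = k *: sbracket x z + sbracket y z;
  sbracketPr : forall (k : R) (x y z : g),
    sbracket z (k *: x + y) = k *: sbracket z x + sbracket z y;
  sbracket_part : forall p q x y,
    x \in spart p -> y \in spart q -> sbracket x y \in spart (p (+) q);
  sbracket_anti : forall p q x y, x \in spart p -> y \in spart q ->
    sbracket x y = - ((-1) ^+ (p && q) *: sbracket y x);
  sbracket_jacobi : forall p q x y z, x \in spart p -> y \in spart q ->
    sbracket x (sbracket y z) =
      sbracket (sbracket x y) z + (-1) ^+ (p && q) *: sbracket y (sbracket x z)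
}.

#[short(type="lieSuperalgType")]
HB.structure Definition LieSuperalgebra (R : fieldType) :=
  { g of isLieSuperalgebra R g & Vector R g }.

Arguments spart {R g} : rename.

(* The projections onto the two parts, and x |-> (-1)^|x| x. *)
Definition sproj (R : fieldType) (g : lieSuperalgType R) (p : bool) (x : g) : g :=
  daddv_pi (spart p) (spart (~~ p)) x.

Definition sinvol (R : fieldType) (g : lieSuperalgType R) (x : g) : g :=
  sproj false x - sproj true x.

(* Noncommutative polynomials; U(g) is their quotient by the algebra axioms,
   linearity of the generators and the super bracket relations. *)
Inductive nc_poly (R X : Type) : Type :=
| NCcst of R
| NCgen of X
| NCadd of nc_poly R X & nc_poly R X
| NCmul of nc_poly R X & nc_poly R X.
Arguments NCcst {R X}. Arguments NCgen {R X}.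

HB.instance Definition _ (R X : Type) := gen_eqMixin (nc_poly R X).
HB.instance Definition _ (R X : Type) := gen_choiceMixin (nc_poly R X).

Fixpoint nc_eval (R : pzRingType) (X : Type) (A : algType R) (f : X -> A)
    (e : nc_poly R X) : A :=
  match e with
  | NCcst k => k%:A
  | NCgen x => f x
  | NCadd e1 e2 => nc_eval f e1 + nc_eval f e2
  | NCmul e1 e2 => nc_eval f e1 * nc_eval f e2
  end.

Inductive uea_eq (R : fieldType) (g : lieSuperalgType R) :
  nc_poly R g -> nc_poly R g -> Prop :=
| Ueq_refl e : uea_eq e e
| Ueq_sym e f : uea_eq e f -> uea_eq f e
| Ueq_trans e f h : uea_eq e f -> uea_eq f h -> uea_eq e h
| Ueq_add e e' f f' :
    uea_eq e e' -> uea_eq f f' -> uea_eq (NCadd e f) (NCadd e' f')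
| Ueq_mul e e' f f' :
    uea_eq e e' -> uea_eq f f' -> uea_eq (NCmul e f) (NCmul e' f')
| Ueq_addA e f h : uea_eq (NCadd e (NCadd f h)) (NCadd (NCadd e f) h)
| Ueq_addC e f : uea_eq (NCadd e f) (NCadd f e)
| Ueq_add0 e : uea_eq (NCadd (NCcst 0) e) e
| Ueq_mulA e f h : uea_eq (NCmul e (NCmul f h)) (NCmul (NCmul e f) h)
| Ueq_mul1 e : uea_eq (NCmul (NCcst 1) e) e
| Ueq_mul0 e : uea_eq (NCmul (NCcst 0) e) (NCcst 0)
| Ueq_mulDl e f h :
    uea_eq (NCmul (NCadd e f) h) (NCadd (NCmul e h) (NCmul f h))
| Ueq_mulDr e f h :
    uea_eq (NCmul e (NCadd f h)) (NCadd (NCmul e f) (NCmul e h))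
| Ueq_cstD k l : uea_eq (NCcst (k + l)) (NCadd (NCcst k) (NCcst l))
| Ueq_cstM k l : uea_eq (NCcst (k * l)) (NCmul (NCcst k) (NCcst l))
| Ueq_cstC k e : uea_eq (NCmul (NCcst k) e) (NCmul e (NCcst k))
| Ueq_lin k x y :
    uea_eq (NCgen (k *: x + y)) (NCadd (NCmul (NCcst k) (NCgen x)) (NCgen y))
| Ueq_bracket p q x y : x \in spart p -> y \in spart q ->
    uea_eq (NCmul (NCgen x) (NCgen y))
      (NCadd (NCmul (NCcst ((-1) ^+ (p && q))) (NCmul (NCgen y) (NCgen x)))
             (NCgen (sbracket x y))).

Section UEA.
Variables (R : fieldType) (g : lieSuperalgType R).

Definition uea_rel (e f : nc_poly R g) : bool := `[< uea_eq e f >].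

Lemma uea_rel_refl : reflexive uea_rel.
Proof. by move=> e; apply/asboolP; constructor. Qed.
Lemma uea_rel_sym : symmetric uea_rel.
Proof. by move=> e f; apply/asboolP/asboolP; apply: Ueq_sym. Qed.
Lemma uea_rel_trans : transitive uea_rel.
Proof. by move=> f e h /asboolP ef /asboolP fh; apply/asboolP/(Ueq_trans ef fh). Qed.

Canonical uea_equiv := EquivRel uea_rel uea_rel_refl uea_rel_sym uea_rel_trans.

Local Open Scope quotient_scope.

Definition uea := {eq_quot uea_rel}.
HB.instance Definition _ := Choice.on uea.

Definition uea_class (e : nc_poly R g) : uea := \pi_uea e.

Lemma uea_classP e f : uea_eq e f -> uea_class e = uea_class f.
Proof. by move=> ef; apply/eqmodP/asboolP. Qed.

Lemma uea_class_eq e f : uea_class e = uea_class f -> uea_eq e f.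
Proof. by move=> /eqmodP/asboolP. Qed.

Lemma uea_reprK (u : uea) : uea_class (repr u) = u.
Proof. exact: reprK. Qed.

Lemma uea_repr (e : nc_poly R g) : uea_eq (repr (uea_class e)) e.
Proof. by apply: uea_class_eq; rewrite uea_reprK. Qed.

Definition uea_add (u v : uea) := uea_class (NCadd (repr u) (repr v)).
Definition uea_mul (u v : uea) := uea_class (NCmul (repr u) (repr v)).
Definition uea_cst (k : R) := uea_class (NCcst k).
Definition uea_opp (u : uea) := uea_mul (uea_cst (-1)) u.

Lemma uea_addE e f : uea_add (uea_class e) (uea_class f) = uea_class (NCadd e f).
Proof. by apply/uea_classP/Ueq_add; apply: uea_repr. Qed.
Lemma uea_mulE e f : uea_mul (uea_class e) (uea_class f) = uea_class (NCmul e f).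
Proof. by apply/uea_classP/Ueq_mul; apply: uea_repr. Qed.

Lemma uea_ind (P : uea -> Prop) : (forall e, P (uea_class e)) -> forall u, P u.
Proof. by move=> Pe u; rewrite -(uea_reprK u). Qed.

Fact uea_addA : associative uea_add.
Proof.
elim/uea_ind=> e; elim/uea_ind=> f; elim/uea_ind=> h.
by rewrite !uea_addE; apply/uea_classP/Ueq_addA.
Qed.
Fact uea_addC : commutative uea_add.
Proof.
by elim/uea_ind=> e; elim/uea_ind=> f; rewrite !uea_addE; apply/uea_classP/Ueq_addC.
Qed.
Fact uea_add0 : left_id (uea_cst 0) uea_add.
Proof. by elim/uea_ind=> e; rewrite uea_addE; apply/uea_classP/Ueq_add0. Qed.
Fact uea_mulA : associative uea_mul.
Proof.
elim/uea_ind=> e; elim/uea_ind=> f; elim/uea_ind=> h.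
by rewrite !uea_mulE; apply/uea_classP/Ueq_mulA.
Qed.
Fact uea_mul1 : left_id (uea_cst 1) uea_mul.
Proof. by elim/uea_ind=> e; rewrite uea_mulE; apply/uea_classP/Ueq_mul1. Qed.
Fact uea_cstC k u : uea_mul (uea_cst k) u = uea_mul u (uea_cst k).
Proof.
by elim/uea_ind: u => e; rewrite !uea_mulE; apply/uea_classP/Ueq_cstC.
Qed.
Fact uea_mulr1 : right_id (uea_cst 1) uea_mul.
Proof. by move=> u; rewrite -uea_cstC uea_mul1. Qed.
Fact uea_mulDl : left_distributive uea_mul uea_add.
Proof.
elim/uea_ind=> e; elim/uea_ind=> f; elim/uea_ind=> h.
by rewrite !(uea_addE, uea_mulE); apply/uea_classP/Ueq_mulDl.
Qed.
Fact uea_mulDr : right_distributive uea_mul uea_add.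
Proof.
elim/uea_ind=> e; elim/uea_ind=> f; elim/uea_ind=> h.
by rewrite !(uea_addE, uea_mulE); apply/uea_classP/Ueq_mulDr.
Qed.
Fact uea_cstD k l : uea_cst (k + l) = uea_add (uea_cst k) (uea_cst l).
Proof. by rewrite uea_addE; apply/uea_classP/Ueq_cstD. Qed.
Fact uea_cstM k l : uea_cst (k * l) = uea_mul (uea_cst k) (uea_cst l).
Proof. by rewrite uea_mulE; apply/uea_classP/Ueq_cstM. Qed.
Fact uea_addN : left_inverse (uea_cst 0) uea_opp uea_add.
Proof.
move=> u; rewrite /uea_opp -[X in uea_add _ X]uea_mul1 -uea_mulDl -uea_cstD addNr.
by elim/uea_ind: u => e; rewrite uea_mulE; apply/uea_classP/Ueq_mul0.
Qed.

Lemma uea_augment (e f : nc_poly R g) : uea_eq e f ->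
  nc_eval (fun=> 0 : R^o) e = nc_eval (fun=> 0 : R^o) f.
Proof.
elim=> //= {e f}; try by move=> *; congruence.
- by move=> *; rewrite addrA.
- by move=> *; rewrite addrC.
- by move=> *; rewrite scale0r add0r.
- by move=> *; rewrite mulrA.
- by move=> *; rewrite scale1r mul1r.
- by move=> *; rewrite scale0r mul0r.
- by move=> *; rewrite mulrDl.
- by move=> *; rewrite mulrDr.
- by move=> *; rewrite scalerDl.
- by move=> k l; rewrite -scalerAl mul1r scalerA.
- by move=> k e; rewrite -scalerAl -scalerAr mul1r mulr1.
- by move=> *; rewrite mulr0 addr0.
- by move=> *; rewrite !mulr0 addr0.
Qed.

Fact uea_1neq0 : uea_cst 1 != uea_cst 0.
Proof.
apply/eqP => /uea_class_eq/uea_augment /= /eqP.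
by rewrite scale0r scale1r oner_eq0.
Qed.

HB.instance Definition _ := GRing.isZmodule.Build uea
  uea_addA uea_addC uea_add0 uea_addN.
HB.instance Definition _ := GRing.Zmodule_isNzRing.Build uea
  uea_mulA uea_mul1 uea_mulr1 uea_mulDl uea_mulDr uea_1neq0.

Definition uea_scale (k : R) (u : uea) : uea := uea_cst k * u.
Fact uea_scaleA k l u : uea_scale k (uea_scale l u) = uea_scale (k * l) u.
Proof. by rewrite /uea_scale mulrA [uea_cst (k * l)]uea_cstM. Qed.
Fact uea_scale1 : left_id 1 uea_scale. Proof. exact: mul1r. Qed.
Fact uea_scaleDr : right_distributive uea_scale +%R.
Proof. by move=> k u v; apply: mulrDr. Qed.
Fact uea_scaleDl u : {morph uea_scale^~ u : k l / k + l}.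
Proof. by move=> k l; rewrite /uea_scale [uea_cst (k + l)]uea_cstD mulrDl. Qed.
HB.instance Definition _ := GRing.Zmodule_isLmodule.Build R uea
  uea_scaleA uea_scale1 uea_scaleDr uea_scaleDl.
Fact uea_scaleAl (k : R) (u v : uea) : k *: (u * v) = (k *: u) * v.
Proof. exact: mulrA. Qed.
HB.instance Definition _ := GRing.Lmodule_isLalgebra.Build R uea uea_scaleAl.
Fact uea_scaleAr (k : R) (u v : uea) : k *: (u * v) = u * (k *: v).
Proof.
rewrite [LHS]mulrA [X in X * _]uea_cstC -[LHS]mulrA; congr (_ * _).
Qed.
HB.instance Definition _ := GRing.Lalgebra_isAlgebra.Build R uea uea_scaleAr.

Definition uea_gen (x : g) : uea := uea_class (NCgen x).

Lemma uea_classE e : uea_class e = nc_eval uea_gen e.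
Proof.
elim: e => //= [k|e <- f <-|e <- f <-].
- by rewrite [RHS]mulr1.
- by rewrite [RHS]uea_addE.
- by rewrite [RHS]uea_mulE.
Qed.

Lemma uea_gen_linear : linear uea_gen.
Proof.
move=> k x y; rewrite /uea_gen (uea_classP (Ueq_lin k x y)).
by rewrite !uea_classE /= -scalerAl mul1r.
Qed.

Lemma uea_gen_bracket p q x y : x \in spart p -> y \in spart q ->
  uea_gen x * uea_gen y - (-1) ^+ (p && q) *: (uea_gen y * uea_gen x)
    = uea_gen (sbracket x y).
Proof.
move=> xp yq; have := uea_classP (Ueq_bracket xp yq).
by rewrite !uea_classE /= -scalerAl mul1r => ->; rewrite addrAC subrr add0r.
Qed.

Section Universal.
Variables (A : algType R) (f : g -> A).
Hypothesis f_lin : linear f.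
Hypothesis f_bracket : forall p q x y, x \in spart p -> y \in spart q ->
  f x * f y - (-1) ^+ (p && q) *: (f y * f x) = f (sbracket x y).

Definition uea_lift (u : uea) : A := nc_eval f (repr u).

Lemma nc_eval_eq (e e' : nc_poly R g) : uea_eq e e' -> nc_eval f e = nc_eval f e'.
Proof.
elim=> //= {e e'}; try by move=> *; congruence.
- by move=> *; rewrite addrA.
- by move=> *; rewrite addrC.
- by move=> *; rewrite scale0r add0r.
- by move=> *; rewrite mulrA.
- by move=> *; rewrite scale1r mul1r.
- by move=> *; rewrite scale0r mul0r.
- by move=> *; rewrite mulrDl.
- by move=> *; rewrite mulrDr.
- by move=> *; rewrite scalerDl.
- by move=> k l; rewrite -scalerAl mul1r scalerA.
- by move=> k e; rewrite -scalerAl -scalerAr mul1r mulr1.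
- by move=> k x y; rewrite f_lin -scalerAl mul1r.
- by move=> p q x y xp yq; rewrite -(f_bracket xp yq) -scalerAl mul1r addrC subrK.
Qed.

Lemma uea_liftE e : uea_lift (uea_class e) = nc_eval f e.
Proof. exact/nc_eval_eq/uea_repr. Qed.

Lemma uea_lift_gen x : uea_lift (uea_gen x) = f x.
Proof. exact: uea_liftE. Qed.

Lemma uea_lift_linear : linear uea_lift.
Proof.
move=> k; elim/uea_ind=> e; elim/uea_ind=> e'.
have -> : k *: uea_class e + uea_class e' = uea_class (NCadd (NCmul (NCcst k) e) e').
  by rewrite !uea_classE /= -scalerAl mul1r.
by rewrite !uea_liftE /= -scalerAl mul1r.
Qed.

Lemma uea_liftM u v : uea_lift (u * v) = uea_lift u * uea_lift v.
Proof.
elim/uea_ind: u => e; elim/uea_ind: v => e'.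
by rewrite [_ * _]uea_mulE !uea_liftE.
Qed.

Lemma uea_lift1 : uea_lift 1 = 1.
Proof. by rewrite [uea_lift 1]uea_liftE /= scale1r. Qed.

End Universal.

End UEA.

Section Smooth.
Variables (R : realType) (E W : normedModType R).

Fixpoint differentiable_upto (n : nat) (D : set E) (f : E -> W) : Prop :=
  if n is n'.+1 then
    (forall x, D x -> differentiable f x) /\
    (forall v, differentiable_upto n' D (fun x => 'D_v f x))
  else True.

(* For [D] open and [E] finite-dimensional this is C^oo on [D]. *)
Definition smooth_on (D : set E) (f : E -> W) : Prop :=
  forall n, differentiable_upto n D f.

End Smooth.

Record chart (R : realType) (G : topologicalType) (n : nat) := Chart {
  chart_dom : set G;
  chart_map : G -> 'rV[R]_n;
  chart_inv : 'rV[R]_n -> G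
}.

Definition chart_cod (R : realType) (G : topologicalType) n (c : chart R G n) :
  set 'rV[R]_n := chart_map c @` chart_dom c.

Definition is_chart (R : realType) (G : topologicalType) n (c : chart R G n) :=
  [/\ open (chart_dom c), open (chart_cod c),
      forall x, chart_dom c x -> chart_inv c (chart_map c x) = x,
      forall x, chart_dom c x -> {for x, continuous (chart_map c)}
    & forall y, chart_cod c y -> {for y, continuous (chart_inv c)}].

Definition smooth_atlas (R : realType) (G : topologicalType) n
    (A : set (chart R G n)) : Prop :=
  [/\ forall c, A c -> is_chart c,
      forall x, exists2 c, A c & chart_dom c x
    & forall c d, A c -> A d ->
        smooth_on (chart_map c @` (chart_dom c `&` chart_dom d))
          (fun y => chart_map d (chart_inv c y))].

HB.mixin Record isLieGroup (R : realType) G of Group G & Topological G := {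
  lie_hausdorff : hausdorff_space G;
  lie_second_countable : @second_countable G;
  lie_dim : nat;
  lie_atlas : set (chart R G lie_dim);
  lie_atlasP : smooth_atlas lie_atlas;
  lie_mul_continuous : continuous (fun p : G * G => (p.1 * p.2)%g);
  lie_inv_continuous : continuous (fun x : G => (x^-1)%g);
  lie_mul_smooth : forall c1 c2 c3,
    lie_atlas c1 -> lie_atlas c2 -> lie_atlas c3 ->
    smooth_on [set y : 'rV[R]_lie_dim * 'rV[R]_lie_dim |
        [/\ chart_cod c1 y.1, chart_cod c2 y.2
          & chart_dom c3 (chart_inv c1 y.1 * chart_inv c2 y.2)%g]]
      (fun y => chart_map c3 (chart_inv c1 y.1 * chart_inv c2 y.2)%g);
  lie_inv_smooth : forall c1 c2, lie_atlas c1 -> lie_atlas c2 ->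
    smooth_on [set y | chart_cod c1 y /\ chart_dom c2 (chart_inv c1 y)^-1%g]
      (fun y => chart_map c2 (chart_inv c1 y)^-1%g)
}.

#[short(type="lieGroupType")]
HB.structure Definition LieGroup (R : realType) :=
  { G of isLieGroup R G & Group G & Topological G }.

Section LieGroupCalculus.
Variables (R : realType) (G : lieGroupType R).
Implicit Types (U : set G) (f : G -> R).

(* Functions on [U] are represented by their extension by zero to [G]. *)
Definition Cinf U : set (G -> R) :=
  [set f | (forall c, lie_atlas c ->
              smooth_on (chart_map c @` (chart_dom c `&` U))
                (fun y => f (chart_inv c y) : R^o))
           /\ forall x, ~ U x -> f x = 0].

Definition smooth_curve (c : R -> G) : Prop :=
  continuous c /\
  forall k, lie_atlas k -> smooth_on [set t : R^o | chart_dom k (c t)]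
                             (fun t : R^o => chart_map k (c t)).

(* The smooth-at-0 curves [c] and [d] define the same tangent vector. *)
Definition same_velocity (c d : R -> G) : Prop :=
  c 0 = d 0 /\
  forall k, lie_atlas k -> chart_dom k (c 0) ->
    [/\ derivable (fun t : R^o => chart_map k (c t)) 0 1,
        derivable (fun t : R^o => chart_map k (d t)) 0 1
      & derive1 (fun t : R^o => chart_map k (c t)) 0 =
        derive1 (fun t : R^o => chart_map k (d t)) 0].

(* [X] matters only through its values on [Cinf setT]. *)
Definition left_invariant_vf (X : (G -> R) -> (G -> R)) : Prop :=
  [/\ forall f, Cinf setT f -> Cinf setT (X f),
      forall k f h, Cinf setT f -> Cinf setT h ->
        X (fun x => k * f x + h x) = (fun x => k * X f x + X h x),
      forall f h, Cinf setT f -> Cinf setT h ->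
        X (fun x => f x * h x) = (fun x => X f x * h x + f x * X h x)
    & forall a f, Cinf setT f ->
        X (fun x => f (a * x)%g) = (fun x => X f (a * x)%g)].

End LieGroupCalculus.

Section InvariantFields.
Variables (R : realType) (G : lieGroupType R) (V : lmodType R) (expo : V -> G).

(* Both act on C^oo(U), hence the extension by zero outside [U]. *)
Definition left_vf (U : set G) (a : V) (f : G -> R) : G -> R :=
  fun x => if x \in U
           then derive1 (fun t : R^o => f (x * expo (t *: a)%R)%g : R^o) 0 else 0.

Definition right_vf (U : set G) (a : V) (f : G -> R) : G -> R :=
  fun x => if x \in U
           then derive1 (fun t : R^o => f (expo (t *: a)%R * x)%g : R^o) 0 else 0.

End InvariantFields.

Record super_HC_pair (R : realType) (G : lieGroupType R)
    (g : lieSuperalgType R) := SuperHCPair {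
  shc_exp : g -> G; (* only relevant on the even part *)
  shc_Ad : G -> g -> g;
  (* The even part of [g] is the Lie algebra of [G], i.e. left-invariant vector
     fields with their commutator, and [shc_exp] is its exponential map. *)
  shc_exp_hom : forall a s t, a \in spart false ->
    shc_exp ((s + t) *: a) = (shc_exp (s *: a)%R * shc_exp (t *: a)%R)%g;
  shc_exp_smooth : forall a, a \in spart false ->
    smooth_curve (fun t => shc_exp (t *: a));
  shc_lie_linear : forall k a b f,
    a \in spart false -> b \in spart false -> Cinf setT f ->
    left_vf shc_exp setT (k *: a + b) f =
      (fun x => k * left_vf shc_exp setT a f x + left_vf shc_exp setT b f x);
  shc_lie_bracket : forall a b f,
    a \in spart false -> b \in spart false -> Cinf setT f ->
    left_vf shc_exp setT (sbracket a b) f =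
      (fun x => left_vf shc_exp setT a (left_vf shc_exp setT b f) x
              - left_vf shc_exp setT b (left_vf shc_exp setT a f) x);
  shc_lie_inj : forall a, a \in spart false ->
    (forall f, Cinf setT f -> left_vf shc_exp setT a f = fun=> 0) -> a = 0;
  shc_lie_surj : forall X, left_invariant_vf X ->
    exists2 a, a \in spart false &
      forall f, Cinf setT f -> X f = left_vf shc_exp setT a f;
  (* [shc_Ad] is a smooth morphism into the automorphism group of [g]. *)
  shc_Ad_linear : forall x k a b,
    shc_Ad x (k *: a + b) = k *: shc_Ad x a + shc_Ad x b;
  shc_Ad_part : forall x p a, a \in spart p -> shc_Ad x a \in spart p;
  shc_Ad_bracket : forall x a b,
    shc_Ad x (sbracket a b) = sbracket (shc_Ad x a) (shc_Ad x b);
  shc_Ad1 : forall a, shc_Ad 1%g a = a;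
  shc_AdM : forall x y a, shc_Ad (x * y)%g a = shc_Ad x (shc_Ad y a);
  shc_Ad_smooth : forall (l : {linear g -> R^o}) a,
    Cinf setT (fun x => l (shc_Ad x a));
  (* On the even part it is the differential at 1 of conjugation. *)
  shc_Ad_adjoint : forall x a, a \in spart false ->
    same_velocity (fun t => shc_exp (t *: shc_Ad x a)%R)
                  (fun t => (x * shc_exp (t *: a)%R * x^-1)%g);
  (* Its differential is the bracket. *)
  shc_Ad_diff : forall (l : {linear g -> R^o}) a b, a \in spart false ->
    is_derive (0 : R^o) (1 : R^o)
      (fun t : R^o => l (shc_Ad (shc_exp (t *: a)) b)) (l (sbracket a b))
}.

Section UEAParity.
Variables (R : fieldType) (g : lieSuperalgType R).

Lemma sproj_id p (x : g) : x \in spart p -> sproj p x = x.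
Proof.
move=> xp; rewrite /sproj daddv_pi_id //.
by case: p xp => _; rewrite ?spart_cap // capvC spart_cap.
Qed.

Lemma sproj_linear p : linear (sproj p : g -> g).
Proof. by move=> k x y; rewrite /sproj linearP. Qed.

Lemma sproj_neq p (x : g) : x \in spart (~~ p) -> sproj p x = 0.
Proof.
move=> xp.
have cap0 : (spart p :&: spart (~~ p) = 0 :> {vspace g})%VS.
  by case: p {xp}; rewrite ?spart_cap // capvC spart_cap.
have sum1 : x \in (spart p + spart (~~ p))%VS.
  by case: p {xp cap0}; rewrite ?[(spart true + _)%VS]addvC spart_sum memvf.
have := daddv_pi_add cap0 sum1; rewrite (daddv_pi_id _ xp) 1?capvC //.
by move=> /(congr1 (fun z => z - x)); rewrite addrK subrr.
Qed.

Lemma sinvol_part p (x : g) : x \in spart p -> sinvol x = (-1) ^+ p *: x.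
Proof.
rewrite /sinvol; case: p => xp.
  by rewrite (sproj_neq (p := false)) // sproj_id // sub0r scaleN1r.
by rewrite (sproj_neq (p := true)) // sproj_id // subr0 scale1r.
Qed.

Lemma sinvol_linear : linear (@sinvol R g).
Proof.
move=> k x y; rewrite /sinvol !sproj_linear scalerBr.
by rewrite opprD addrACA.
Qed.

(* The algebra automorphism of U(g) acting by (-1)^|u| on homogeneous u. *)
Definition uea_parity : uea g -> uea g :=
  uea_lift (fun x : g => uea_gen (sinvol x)).

Let f (x : g) : uea g := uea_gen (sinvol x).

Let f_lin : linear f.
Proof. by move=> k x y; rewrite /f sinvol_linear uea_gen_linear. Qed.

Let genZ (k : R) (x : g) : uea_gen (k *: x) = k *: uea_gen x.
Proof.
have gen0 : uea_gen (0 : g) = 0.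
  have := uea_gen_linear (1 : R) (0 : g) 0.
  by rewrite !scale1r addr0 -[LHS]addr0 => /addrI <-.
by have := uea_gen_linear k x 0; rewrite gen0 !addr0.
Qed.

Let f_bracket p q x y : x \in spart p -> y \in spart q ->
  f x * f y - (-1) ^+ (p && q) *: (f y * f x) = f (sbracket x y).
Proof.
move=> xp yq; rewrite /f (sinvol_part xp) (sinvol_part yq).
rewrite (sinvol_part (sbracket_part _ _ _ _ xp yq)) !genZ -(uea_gen_bracket xp yq).
rewrite -!scalerAl -!scalerAr !scalerA [RHS]scalerBr scalerA signr_addb.
congr (_ *: _ - _ *: _).
by rewrite -mulrA mulrC [(-1) ^+ q * _]mulrC.
Qed.

Lemma uea_parity_gen p x : x \in spart p ->
  uea_parity (uea_gen x) = (-1) ^+ p *: uea_gen x.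
Proof.
by move=> xp; rewrite /uea_parity (uea_lift_gen f_lin f_bracket) /f (sinvol_part xp) genZ.
Qed.

Lemma uea_parity_linear : linear uea_parity.
Proof. exact: uea_lift_linear f_lin f_bracket. Qed.

Lemma uea_parityM u v : uea_parity (u * v) = uea_parity u * uea_parity v.
Proof. exact: uea_liftM f_lin f_bracket _ _. Qed.

Lemma uea_parity1 : uea_parity 1 = 1.
Proof. exact: uea_lift1 f_lin f_bracket. Qed.

End UEAParity.

Section Symmetrization.
Variables (R : fieldType) (g : lieSuperalgType R).

(* The image of a_0 /\ ... /\ a_(p-1) under gamma, see [gamma_wedge]. *)
Definition antisym p (a : 'I_p -> g) : uea g :=
  (p`!%:R : R)^-1 *:
    \sum_(s : 'S_p) (-1) ^+ s *: \prod_(i < p) uea_gen (a (s i)).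

Definition odd_dim : nat := \dim (spart true : {vspace g}).
Definition odd_basis (i : 'I_odd_dim) : g := (vbasis (spart true))`_i.

(* The exterior algebra of the odd part, with coefficients in [A]: the value at
   [S] is the coefficient of the wedge product, in increasing order, of the
   basis vectors with index in [S]. *)
Definition exterior (A : Type) := {ffun {set 'I_odd_dim} -> A}.

Definition ext_basis (S : {set 'I_odd_dim}) : exterior R :=
  [ffun T => (T == S)%:R].

Definition gamma (w : exterior R) : uea g :=
  \sum_S w S *: antisym (fun i : 'I_#|S| => odd_basis (enum_val i)).

End Symmetrization.

Section ExteriorTheory.
Variables (R : fieldType) (g : lieSuperalgType R).
Local Notation m := (odd_dim g).
Local Notation odd := (spart true : {vspace g}).

(* The coordinate of a_0 /\ ... /\ a_(p-1) on [ext_basis S]. *)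
Definition wedge_coord p (a : 'I_p -> g) (S : {set 'I_m}) : R :=
  if #|S| =P p is ReflectT e then
    \det (\matrix_(i < #|S|, j < #|S|)
            coord (vbasis odd) (enum_val j) (a (cast_ord e i)))
  else 0.

Definition wedge p (a : 'I_p -> g) : exterior g R :=
  [ffun S => wedge_coord a S].

Lemma gamma_wedge p (a : 'I_p -> g) :
  (forall i, a i \in odd) -> gamma (wedge a) = antisym a.
Proof.
move=> a_odd.
pose A (i : 'I_p) (k : 'I_m) : R := coord (vbasis odd) k (a i).
pose b (k : 'I_m) := uea_gen (odd_basis k).
pose L := GRing.isLinear.Build R g (uea g) *:%R (@uea_gen R g) (@uea_gen_linear R g).
pose gen : {linear g -> uea g} := HB.pack (@uea_gen R g) L.
have genE i : uea_gen (a i) = \sum_k A i k *: b k.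
  rewrite {1}(coord_vbasis (a_odd i)) -[LHS]/(gen _) linear_sum /=.
  by apply: eq_bigr => k _; rewrite -[LHS]/(gen _) linearZ.
pose D (f : {ffun 'I_p -> 'I_m}) := \det (\matrix_(i, j) A i (f j)).
have antisymE : antisym a = (p`!%:R)^-1 *: \sum_(f : {ffun 'I_p -> 'I_m}) D f *: \prod_i b (f i).
  congr (_ *: _).
  under eq_bigr => s _.
    under eq_bigr => i _ do rewrite genE.
    rewrite bigA_distr_bigA /= scaler_sumr.
    over.
  rewrite exchange_big /=; apply: eq_bigr => f _.
  rewrite /D -det_tr /determinant scaler_suml; apply: eq_bigr => s _.
  rewrite scaler_prod scalerA; congr ((_ * _) *: _).
  by apply: eq_bigr => i _; rewrite !mxE.
have D0 (f : {ffun 'I_p -> 'I_m}) : ~~ injectiveb f -> D f = 0.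
  case/injectivePn => i [j ij fij].
  rewrite /D -det_tr; apply: (determinant_alternate ij) => k.
  by rewrite !mxE fij.
rewrite antisymE (bigID (fun f : {ffun 'I_p -> 'I_m} => injectiveb f)) /= [X in _ + X]big1 ?addr0; last first.
  by move=> f /D0 ->; rewrite scale0r.
rewrite (partition_big (fun f : {ffun 'I_p -> 'I_m} => [set f i | i in 'I_p]%SET) xpredT) //=.
rewrite scaler_sumr; apply: eq_bigr => S _.
rewrite ffunE /wedge_coord; case: eqP => [e|ne]; last first.
  rewrite scale0r big_pred0 ?scaler0 // => f.
  apply/negP => /andP[/injectiveP f_inj /eqP Sf].
  by apply: ne; rewrite -Sf card_imset // card_ord.
case: p / e a a_odd @A genE @D {antisymE} D0 => a a_odd A genE D D0.
pose E (i : 'I_#|S|) : 'I_m := enum_val i.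
pose F (s : 'S_#|S|) : {ffun 'I_#|S| -> 'I_m} := [ffun i => E (s i)].
have E_inj : injective E by exact: enum_val_inj.
have F_inj : injective F.
  move=> s t /ffunP st; apply/permP => i; apply: E_inj.
  by have := st i; rewrite !ffunE.
have F_im (f : {ffun 'I_#|S| -> 'I_m}) :
    injectiveb f && ([set f i | i in 'I_#|S|]%SET == S) = (f \in F @: [set: 'S_#|S|]%SET).
  apply/idP/imsetP => [/andP[/injectiveP f_inj /eqP fS]|[s _ ->]].
    have fiS i : f i \in S by have /finset.setP/(_ (f i)) <- := fS; apply: imset_f.
    have h_inj : injective (fun i => enum_rank_in (fiS i) (f i)).
      move=> i j /(congr1 E); rewrite /E !enum_rankK_in //.
      exact: f_inj.
    exists (perm h_inj) => //; apply/ffunP => i.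
    by rewrite ffunE permE /E enum_rankK_in.
  apply/andP; split.
    by apply/injectiveP => i j; rewrite !ffunE => /E_inj/perm_inj.
  rewrite eqEcard card_imset ?card_ord ?leqnn ?andbT; last first.
    by move=> i j; rewrite !ffunE => /E_inj/perm_inj.
  by apply/fintype.subsetP => _ /imsetP[i _ ->]; rewrite ffunE /E; apply: enum_valP.
rewrite (eq_bigl _ _ F_im) big_imset /=; last by move=> s t _ _; apply: F_inj.
rewrite /antisym scalerA mulrC -scalerA; congr (_ *: _); rewrite scaler_sumr.
rewrite [RHS](eq_bigl xpredT) => [|s]; last by rewrite finset.in_setT.
apply: eq_bigr => s _; rewrite scalerA; congr (_ *: _).
  rewrite /D.
  have -> : \matrix_(i, j) A i (F s j) =
      col_perm s (\matrix_(i < #|S|, j < #|S|) coord (vbasis odd) (E j) (a (cast_ord (erefl #|S|) i))).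
    by apply/matrixP => i j; rewrite !mxE ffunE cast_ord_id.
  by rewrite col_permE det_mulmx det_perm odd_permV.
by apply: eq_bigr => i _; rewrite ffunE.
Qed.
End ExteriorTheory.

(* C^oo(U) (x) Lambda(g_1^* ) is the set of [f : exterior g (G -> R)] with
   coefficients in C^oo(U): [f] stands for \sum_S f_S (x) e^S, where e^S is the
   basis dual to [ext_basis]; equivalently, [f] is the linear map from
   [exterior g R] to C^oo(U) sending [ext_basis S] to [f S]. *)
Section ExteriorFunctions.
Variables (R : realType) (G : lieGroupType R) (g : lieSuperalgType R).
Variable U : set G.
Local Notation m := (odd_dim g).
Implicit Types (f h : exterior g (G -> R)) (X : (G -> R) -> G -> R).

Definition Cinf_ext : set (exterior g (G -> R)) :=
  [set f | forall S, Cinf U (f S)].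

Definition ext_homog (p : nat) : set (exterior g (G -> R)) :=
  [set f | forall S : {set 'I_m}, #|S| <> p -> f S = 0].

(* e^S /\ e^T = ext_sign S T e^(S :|: T) for disjoint S and T. *)
Definition ext_sign (S T : {set 'I_m}) : R :=
  (-1) ^+ #|[set ij : 'I_m * 'I_m |
              [&& ij.1 \in S, ij.2 \in T & (ij.2 < ij.1)%N]]%SET|.

Definition ext_mul f h : exterior g (G -> R) :=
  [ffun S : {set 'I_m} => \sum_(T : {set 'I_m} | T \subset S)
               (fun x => ext_sign T (S :\: T) * (f T x * h (S :\: T)%SET x))].

Definition ext_fun (c : G -> R) : exterior g (G -> R) :=
  [ffun S : {set 'I_m} => if S == finset.set0 then c else 0].

Definition ext_covector (i : 'I_m) : exterior g (G -> R) :=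
  [ffun S : {set 'I_m} => if S == [set i]%SET then (fun x => (x \in U)%:R) else 0].

(* A vector field X as a derivation; cf. [vf_ext_derivation], [vf_ext_fun] and
   [vf_ext_covector]. *)
Definition vf_ext X f : exterior g (G -> R) := [ffun S => X (f S)].

Section Derivation.
Variable X : (G -> R) -> G -> R.
Hypothesis Cinf_linear : forall (k : R) (c d : G -> R),
  Cinf U c -> Cinf U d -> Cinf U (fun x => k * c x + d x).
Hypothesis Cinf_mul : forall c d : G -> R,
  Cinf U c -> Cinf U d -> Cinf U (fun x => c x * d x).
Hypothesis Cinf1 : Cinf U (fun x => (x \in U)%:R).
Hypothesis X_linear : forall (k : R) (c d : G -> R),
  Cinf U c -> Cinf U d -> X (fun x => k * c x + d x) = (fun x => k * X c x + X d x).
Hypothesis X_mul : forall c d : G -> R, Cinf U c -> Cinf U d ->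
  X (fun x => c x * d x) = (fun x => X c x * d x + c x * X d x).

Let Cinf0 : Cinf U 0.
Proof.
have -> : 0 = (fun x : G => -1 * (x \in U)%:R + (x \in U)%:R :> R).
  by apply/funext => x; rewrite mulN1r addNr.
exact: Cinf_linear.
Qed.

Let X0 : X 0 = 0.
Proof.
have /(_ 1) := X_linear _ Cinf0 Cinf0.
have -> : (fun x : G => 1 * (0 : G -> R) x + (0 : G -> R) x) = 0.
  by apply/funext => x; rewrite mulr0 addr0.
move=> /funeqP X00; apply/funext => x; have := X00 x.
by rewrite mul1r -[LHS]addr0 => /addrI <-.
Qed.

Lemma vf_ext_derivation f h : Cinf_ext f -> Cinf_ext h ->
  vf_ext X (ext_mul f h) = ext_mul (vf_ext X f) h + ext_mul f (vf_ext X h).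
Proof.
move=> fC hC; apply/ffunP => S; rewrite !ffunE.
have Cprod T T' (k : R) : Cinf U (fun x => k * (f T x * h T' x)).
  have := Cinf_linear k (Cinf_mul (fC T) (hC T')) Cinf0.
  by congr (Cinf U _); apply/funext => x; rewrite addr0.
have Xprod T T' (k : R) : X (fun x => k * (f T x * h T' x)) =
    (fun x => k * (X (f T) x * h T' x)) + (fun x => k * (f T x * X (h T') x)).
  have := X_linear k (Cinf_mul (fC T) (hC T')) Cinf0.
  rewrite X_mul // X0 => XE; transitivity (X (fun x => k * (f T x * h T' x) + (0 : G -> R) x)).
    by congr X; apply/funext => x; rewrite addr0.
  by rewrite XE; apply/funext => x; rewrite addr0 mulrDr.
rewrite -big_split /=.
pose Q (s t : G -> R) := Cinf U s /\ X s = t.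
suff [] : Q (\sum_(T : {set 'I_m} | T \subset S)
               (fun x => ext_sign T (S :\: T) * (f T x * h (S :\: T)%SET x)))
  (\sum_(T : {set 'I_m} | T \subset S)
     ((fun x => ext_sign T (S :\: T) * (vf_ext X f T x * h (S :\: T)%SET x))
    + (fun x => ext_sign T (S :\: T) * (f T x * vf_ext X h (S :\: T)%SET x)))) by [].
apply: (big_ind2 Q) => [|s t s' t' [sC <-] [s'C <-]|T TS].
- by split.
- have e1 : s + s' = (fun x => 1 * s x + s' x) by apply/funext => x; rewrite mul1r.
  rewrite /Q e1; split; first exact: Cinf_linear.
  by rewrite X_linear //; apply/funext => x; rewrite mul1r.
- split; first exact: Cprod.
  by rewrite Xprod !ffunE.
Qed.

Lemma vf_ext_fun c : vf_ext X (ext_fun c) = ext_fun (X c).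
Proof. by apply/ffunP => S; rewrite !ffunE; case: ifP. Qed.

Lemma vf_ext_covector i : vf_ext X (ext_covector i) = 0.
Proof.
apply/ffunP => S; rewrite !ffunE; case: ifP => // _.
have := X_mul Cinf1 Cinf1.
have -> : (fun x : G => (x \in U)%:R * (x \in U)%:R) = (fun x => (x \in U)%:R) :> (G -> R).
  by apply/funext => x; rewrite -natrM mulnb andbb.
move=> /funeqP X1; apply/funext => x; have := X1 x.
have [xU|xU] := boolP (x \in U); last by rewrite mulr0 mul0r addr0.
by rewrite mulr1 mul1r -[LHS]addr0 => /addrI <-.
Qed.

End Derivation.
End ExteriorFunctions.

Arguments Cinf_ext {R G} g U.
Arguments ext_homog {R G g} p.

Section Supergroup.
Variables (R : realType) (G : lieGroupType R) (g : lieSuperalgType R).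
Variables (P : super_HC_pair G g) (U : set G).
Local Notation expo := (shc_exp P).
Local Notation even := (subvs_of (spart false : {vspace g})).

(* The elements of U(g_0) are the classes of the polynomials [e]. *)
Fixpoint even_act (e : nc_poly R even) (f : G -> R) : G -> R :=
  match e with
  | NCcst k => fun x => k * f x
  | NCgen b => left_vf expo U (vsval b) f
  | NCadd e1 e2 => fun x => even_act e1 f x + even_act e2 f x
  | NCmul e1 e2 => even_act e1 (even_act e2 f)
  end.

(* Hom_{U(g_0)}(U(g), C^oo(U)). *)
Definition supersheaf : set (uea g -> G -> R) :=
  [set F | [/\ forall u, Cinf U (F u),
               forall u v, F (u + v) = (fun x => F u x + F v x)
             & forall (e : nc_poly R even) u,
                 F (nc_eval (fun b : even => uea_gen (vsval b)) e * u) =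
                 even_act e (F u)]].

(* The formula (-1)^(|F||a|) F((Ad_{x^-1} a) u)(x), extended additively to all
   [F] and [a]: on homogeneous [F] one has (-1)^|F| F = F \o uea_parity. *)
Definition right_hat (a : g) (F : uea g -> G -> R) : uea g -> G -> R :=
  fun u x =>
    F (uea_gen (shc_Ad P x^-1%g (sproj false a)) * u) x +
    F (uea_parity (uea_gen (shc_Ad P x^-1%g (sproj true a)) * u)) x.

Lemma right_hat_homog (p q : bool) (a : g) (F : uea g -> G -> R) :
  a \in spart p -> (forall x, F 0 x = 0) ->
  (forall u x, F (uea_parity u) x = (-1) ^+ q * F u x) ->
  forall u x, right_hat a F u x =
    (-1) ^+ (q && p) * F (uea_gen (shc_Ad P x^-1%g a) * u) x.
Proof.
move=> ap F0 FP u x; rewrite /right_hat.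
have Ad0 : uea_gen (shc_Ad P x^-1%g 0) = 0.
  have Ad00 : shc_Ad P x^-1%g 0 = 0.
    have := shc_Ad_linear P x^-1%g (-1) 0 0.
    by rewrite scaler0 addr0 scaleN1r addNr.
  have := uea_gen_linear (-1 : R) (0 : g) 0.
  by rewrite Ad00 scaler0 addr0 scaleN1r addNr.
have par0 : uea_parity (0 : uea g) = 0.
  have := uea_parity_linear (-1 : R) (0 : uea g) 0.
  by rewrite scaler0 addr0 scaleN1r addNr.
case: p ap => ap.
  by rewrite (sproj_neq (p := false)) // sproj_id // Ad0 mul0r F0 add0r FP andbT.
rewrite (sproj_neq (p := true)) // sproj_id // Ad0 mul0r par0 F0 addr0.
by rewrite andbF mul1r.
Qed.

Definition right_hat0 (a : g) : (G -> R) -> G -> R := right_vf expo U a.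

Definition gamma_pull (F : uea g -> G -> R) : exterior g (G -> R) :=
  [ffun S => F (gamma (ext_basis S))].

(* [right_hat a] transported along [gamma_pull]. *)
Definition right_hat_ext (a : g) (f : exterior g (G -> R)) :
    exterior g (G -> R) :=
  gamma_pull (right_hat a
    (xget (fun _ _ => 0) [set F | supersheaf F /\ gamma_pull F = f])).

End Supergroup.

(* Main.v *)
Require Import Defs.
From HB Require Import structures.
From mathcomp Require Import all_boot all_order all_algebra all_fingroup.
From mathcomp Require Import all_classical all_reals all_analysis.

(** The point is the identity exp(t a) x = x (x^-1 exp(t a) x).  By definition
    the value of [right_hat P a F] at u and x is F((Ad_{x^-1} a) u)(x), and
    since Ad_{x^-1} a is again even, linearity of F over U(g_0) turns it into
    the derivative of F(u) at x along the left-invariant field of Ad_{x^-1} a,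
    that is along the curve t |-> x exp(t Ad_{x^-1} a).  The right-invariant
    field of a differentiates F(u) along t |-> exp(t a) x, which is the left
    translate by x of the conjugate curve t |-> x^-1 exp(t a) x.  On the even
    part Ad is the differential of conjugation, so exp(t Ad_{x^-1} a) and the
    conjugate curve have the same velocity at the identity; the chain rule,
    [Cinf_lmul_same_velocity], then makes both derivatives equal
    ([right_hat_even]).

    This holds for every u in U(g), so in particular for the elements of the
    image of [gamma].  The transported operator thus acts separately on each
    coefficient, which gives the statements about the exterior degree. *)

Set Implicit Arguments.
Unset Strict Implicit.
Unset Printing Implicit Defensive.

Import Order.TTheory GRing.Theory Num.Theory.
Import numFieldNormedType.Exports.

Local Open Scope classical_set_scope.
Local Open Scope ring_scope.

Section TangentVectors.
Variables (R : realType) (G : lieGroupType R).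
Local Notation chartG := (chart R G (@lie_dim R G)).
Implicit Types (U : set G) (f : G -> R) (x y : G) (k : chartG) (c d : R -> G).

Lemma chartK k y : lie_atlas k -> chart_dom k y ->
  chart_inv k (chart_map k y) = y.
Proof.
have [chartA _ _] := lie_atlasP (s := G).
by move=> /chartA[_ _ kK _ _]; apply: kK.
Qed.

Lemma lmul_continuous x : continuous (fun y => (x * y)%g).
Proof.
move=> y.
apply: (@continuous_comp _ _ _ (fun z => (x, z)) (fun p : G * G => (p.1 * p.2)%g)).
  by apply: cvg_pair; [exact: cvg_cst | exact: cvg_id].
exact: lie_mul_continuous.
Qed.

Lemma rmul_continuous x : continuous (fun y => (y * x)%g).
Proof.
move=> y.
apply: (@continuous_comp _ _ _ (fun z => (z, x)) (fun p : G * G => (p.1 * p.2)%g)).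
  by apply: cvg_pair; [exact: cvg_id | exact: cvg_cst].
exact: lie_mul_continuous.
Qed.

Lemma Cinf_chart_differentiable U f k y : Cinf U f -> lie_atlas k ->
  chart_dom k y -> U y ->
  differentiable (fun v => f (chart_inv k v) : R^o) (chart_map k y).
Proof.
move=> [fC _] kA ky Uy; have [+ _] := fC k kA 1%N; apply.
by exists y.
Qed.

(** Freezing one factor of the jointly smooth multiplication. *)
Lemma lmul_chart_differentiable x k k' y : lie_atlas k -> lie_atlas k' ->
  chart_dom k y -> chart_dom k' (x * y)%g ->
  differentiable (fun v => chart_map k' (x * chart_inv k v)%g) (chart_map k y).
Proof.
move=> kA k'A ky k'xy.
have [_ /(_ x)[h hA hx] _] := lie_atlasP (s := G).
have -> : (fun v => chart_map k' (x * chart_inv k v)%g) =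
    (fun p : 'rV[R]__ * 'rV[R]__ =>
       chart_map k' (chart_inv h p.1 * chart_inv k p.2)%g)
    \o (fun v => (chart_map h x, v)).
  by apply/funext => v /=; rewrite chartK.
apply: differentiable_comp.
  by apply: differentiable_pair; [exact: differentiable_cst | exact: ex_diff].
have [+ _] := lie_mul_smooth _ _ _ hA kA k'A 1%N; apply => /=.
by split; [exists x | exists y | rewrite !chartK].
Qed.

(** The chain rule for the composite of the curve, read in a chart k, with
    left translation by x, read in k and k', and with f, read in k'. *)
Lemma derive1_lmul_curve U f x k k' c : Cinf U f ->
  lie_atlas k -> lie_atlas k' ->
  {for (0 : R), continuous c} ->
  chart_dom k (c 0) -> chart_dom k' (x * c 0)%g -> U (x * c 0)%g ->
  derivable (fun t : R^o => chart_map k (c t)) 0 1 ->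
  derive1 (fun t : R^o => f (x * c t)%g : R^o) 0 =
  'd (fun v => f (chart_inv k' (chart_map k' (x * chart_inv k v)%g)) : R^o)
     (chart_map k (c 0)) (derive1 (fun t : R^o => chart_map k (c t)) 0).
Proof.
move=> fC kA k'A cc kc k'c Uc dc.
set H := (fun v => f (chart_inv k' _) : R^o); set K := (fun t : R^o => chart_map k (c t)).
have dK : differentiable K (0 : R^o) by apply/derivable1_diffP.
have dH : differentiable H (chart_map k (c 0)).
  apply: (@differentiable_comp _ _ _ _
            (fun v => chart_map k' (x * chart_inv k v)%g)
            (fun w => f (chart_inv k' w) : R^o)).
    exact: lmul_chart_differentiable.
  by rewrite chartK //; apply: Cinf_chart_differentiable fC _ _ _.
have [chartA _ _] := lie_atlasP (s := G).
have [ok _ _ _ _] := chartA _ kA; have [ok' _ _ _ _] := chartA _ k'A.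
(* near 0 the curve stays where the charts k and k' can be inverted *)
have fE : \forall t \near (0 : R^o), f (x * c t)%g = (H \o K) t.
  have nk : \forall t \near (0 : R^o), chart_dom k (c t).
    by apply: cc; apply: open_nbhs_nbhs.
  have nk' : \forall t \near (0 : R^o), chart_dom k' (x * c t)%g.
    have xc : {for (0 : R^o), continuous (fun t : R^o => (x * c t)%g)}.
      by apply: continuous_comp; [exact: cc | exact: lmul_continuous].
    by apply: xc; apply: open_nbhs_nbhs.
  near=> t; rewrite /H /K /= (chartK kA); last by near: t.
  by rewrite (chartK k'A) //; near: t.
rewrite !derive1E (near_eq_derive _ fE) !deriveE //; last exact: differentiable_comp.
by rewrite diff_comp.
Unshelve. all: by end_near.
Qed.

Lemma Cinf_lmul_same_velocity U f x c d : Cinf U f -> same_velocity c d ->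
  {for (0 : R), continuous c} -> {for (0 : R), continuous d} ->
  U (x * c 0)%g ->
  derive1 (fun t : R^o => f (x * c t)%g : R^o) 0 =
  derive1 (fun t : R^o => f (x * d t)%g : R^o) 0.
Proof.
move=> fC [cd0 cd] cc cd_cont Uc.
have [_ covA _] := lie_atlasP (s := G).
have [k kA kc] := covA (c 0); have [k' k'A k'c] := covA (x * c 0)%g.
have [dc dd cd'] := cd k kA kc.
rewrite (derive1_lmul_curve fC kA k'A) // cd' cd0.
by rewrite -(derive1_lmul_curve fC kA k'A) // -cd0.
Qed.

End TangentVectors.

Section EvenRightInvariant.
Variables (R : realType) (G : lieGroupType R) (g : lieSuperalgType R).
Variables (P : super_HC_pair G g) (U : set G).
Implicit Types (F : uea g -> G -> R) (a b : g).

Lemma shc_exp0 : shc_exp P 0 = 1%g.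
Proof.
have := shc_exp_hom P 0 0 (mem0v (spart false : {vspace g})).
by rewrite !scaler0 -[LHS]mulg1 => /mulgI.
Qed.

Lemma supersheaf_gen F b u : supersheaf P U F -> b \in spart false ->
  F (uea_gen b * u) = left_vf (shc_exp P) U b (F u).
Proof. by move=> [_ _ F_lin] b_even; have := F_lin (NCgen (Subvs b_even)) u. Qed.

Lemma supersheaf0 F : supersheaf P U F -> F 0 = 0.
Proof.
move=> [_ FD _]; apply/funext => x; have /(congr1 (@^~ x)) := FD 0 0.
by rewrite addr0 -[LHS]addr0 => /addrI <-.
Qed.

Lemma uea_gen0 : uea_gen (0 : g) = 0.
Proof.
by have := uea_gen_linear (-1 : R) (0 : g) 0; rewrite scaler0 addr0 scaleN1r addNr.
Qed.

Lemma shc_Ad0 x : shc_Ad P x 0 = 0.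
Proof.
by have := shc_Ad_linear P x (-1) 0 0; rewrite scaler0 addr0 scaleN1r addNr.
Qed.

Lemma uea_parity0 : uea_parity (0 : uea g) = 0.
Proof.
have := uea_parity_linear (-1 : R) (0 : uea g) 0.
by rewrite scaler0 addr0 scaleN1r addNr.
Qed.

(** The argument u is arbitrary because left multiplication by the even element
    Ad_{x^-1} a is absorbed by the linearity of F over U(g_0), which leaves u
    untouched; the parity term of [right_hat] only sees the odd part of a. *)
Lemma right_hat_even a F u : a \in spart false -> supersheaf P U F ->
  right_hat P a F u = right_hat0 P U a (F u).
Proof.
move=> a_even FS; apply/funext => x.
rewrite /right_hat (sproj_neq (p := true)) // sproj_id // shc_Ad0 uea_gen0.
rewrite mul0r uea_parity0 supersheaf0 // addr0.
rewrite (supersheaf_gen _ FS) ?shc_Ad_part // /right_hat0 /left_vf /right_vf.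
have [/set_mem Ux|//] := boolP (x \in U).
have [FC _ _] := FS.
have exp_cont b : b \in spart false -> continuous (fun t : R => shc_exp P (t *: b)).
  by move=> b_even; have [] := shc_exp_smooth P b_even.
rewrite (Cinf_lmul_same_velocity (FC u) (shc_Ad_adjoint P x^-1%g a_even)).
- by congr (derive1 _ 0); apply/funext => t; rewrite invgK !mulgA mulgV mul1g.
- exact/exp_cont/shc_Ad_part.
- apply: (@continuous_comp _ _ _ (fun t : R => (x^-1 * shc_exp P (t *: a)%R)%g)
            (fun y : G => (y * x^-1^-1)%g)); last exact: rmul_continuous.
  by apply: continuous_comp; [exact: exp_cont | exact: lmul_continuous].
- by rewrite scale0r shc_exp0 mulg1.
Qed.

Lemma gamma_pull_right_hat_even a F : a \in spart false -> supersheaf P U F ->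
  gamma_pull (right_hat P a F) = vf_ext (right_hat0 P U a) (gamma_pull F).
Proof. by move=> a_even FS; apply/ffunP => S; rewrite !ffunE right_hat_even. Qed.

Lemma vf_ext_homog (X : (G -> R) -> G -> R) p (f : exterior g (G -> R)) :
  X 0 = 0 -> ext_homog p f -> ext_homog p (vf_ext X f).
Proof. by move=> X0 fp S Sp; rewrite ffunE fp. Qed.

Lemma right_hat0_0 a : right_hat0 P U a 0 = 0.
Proof.
apply/funext => x; rewrite /right_hat0 /right_vf; case: ifP => // _.
exact: derive1_cst.
Qed.

End EvenRightInvariant.

Theorem proposition2p14 (R : realType) (G : lieGroupType R)
    (g : lieSuperalgType R) (P : super_HC_pair G g) (U : set G)
    (U_open : open U) (a : g) (a_even : a \in spart false) :
  [/\ forall F, supersheaf P U F ->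
        gamma_pull (right_hat P a F) =
        vf_ext (right_hat0 P U a) (gamma_pull F),
      forall p F, supersheaf P U F -> ext_homog p (gamma_pull F) ->
        ext_homog p (gamma_pull (right_hat P a F))
    & set_bij (supersheaf P U) (Cinf_ext g U) (@gamma_pull R G g) ->
      forall f, Cinf_ext g U f ->
        right_hat_ext P U a f = vf_ext (right_hat0 P U a) f /\
        forall p, ext_homog p f -> ext_homog p (right_hat_ext P U a f)].
Proof.
have FE F := @gamma_pull_right_hat_even _ _ _ P U a F a_even.
have homog := vf_ext_homog (right_hat0_0 P U a).
split=> [F /FE //|p F /FE -> /homog //|[_ _ surj] f /surj[F0 F0S F0f]].
rewrite /right_hat_ext; set F := xget _ _.
have [FS <-] : supersheaf P U F /\ gamma_pull F = f.
  exact: (xgetI (P := [set F | supersheaf P U F /\ gamma_pull F = f]) _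
                (conj F0S F0f)).
by rewrite FE //; split=> // p /homog.
Qed.
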